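(* Let $A$ be an $n\times n$ integer matrix with nonzero determinant, and let $\rho(A)$ be the spectral radius of $A$. Then there exist two positive constants $C_1\ge C_0>0$ and a unique integer $\ell$ with $0\le \ell\le n-1$ such that $$C_0\cdot k^{\ell}\cdot\rho(A)^k\le \deg(f_A^k)\le C_1\cdot k^{\ell}\cdot\rho(A)^k$$ for all positive integers $k$. In fact, $\ell+1$ is the size of the largest Jordan block of $A$ among those corresponding to eigenvalues of maximal modulus.
   Context: For an integer matrix $A=(a_{i,j})$ of size $n\times n$, $f_A$ denotes the monomial map $f_A(x_1,\dots,x_n)=(\prod_j x_j^{a_{1,j}},\dots,\prod_j x_j^{a_{n,j}})$ and also the rational map $\mathbb{P}^n\dashrightarrow\mathbb{P}^n$ it induces via the embedding $(X_1,\dots,X_n)\mapsto[1;X_1;\dots;X_n]$. $f_A^k$ is the $k$-th iterate, equal to $f_{A^k}$. The degree $\deg(f)$ of a rational map $f:\mathbb{P}^n\dashrightarrow\mathbb{P}^n$ is the common degree of the homogeneous polynomials without common factor defining $f$ (equivalently, the integer by which the pull back $f^*$ acts on $\mathrm{Pic}(\mathbb{P}^n)\cong\mathbb{Z}$). Jordan blocks are taken over $\mathbb{C}$. *)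

(* Defs.v *)
From mathcomp Require Import all_boot all_order all_algebra.
From mathcomp Require Import boolp classical_sets reals.
From mathcomp Require Import complex mpoly.

Set Implicit Arguments.
Unset Strict Implicit.
Unset Printing Implicit Defensive.

Import Order.TTheory GRing.Theory Num.Theory.
Local Open Scope ring_scope.

Section RationalMaps.
Variables (K : closedFieldType) (n : nat).

Definition in_torus (x : 'rV[K]_n) : Prop := forall j, x 0 j != 0.

(* Only meaningful on the torus: a negative power of 0 is 0 in this library. *)
Definition monomial_map (A : 'M[int]_n) (x : 'rV[K]_n) : 'rV[K]_n :=
  \row_i \prod_j x 0 j ^ A i j.

(* Homogeneous coordinates of the point [1; x_1; ...; x_n] of P^n. *)
Definition affine_chart (x : 'rV[K]_n) : 'rV[K]_n.+1 := row_mx (1 : 'rV[K]_1) x.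

(* No common factor. This excludes F = 0, of which every polynomial,
   'X_0 for instance, is a factor. *)
Definition no_common_factor (F : 'I_n.+1 -> {mpoly K[n.+1]}) : Prop :=
  forall g : {mpoly K[n.+1]},
    (forall i, exists h : {mpoly K[n.+1]}, F i = g * h) -> g \is a GRing.unit.

(* [F_0 : ... : F_n] : P^n --> P^n extends the self-map f of the torus, which is
   embedded in P^n by the chart above: at [1; x], x in the torus, the F_i are
   homogeneous coordinates of the point [1; f x]. Since K is infinite the torus
   is Zariski dense, so this determines the rational map. *)
Definition induces (F : 'I_n.+1 -> {mpoly K[n.+1]}) (f : 'rV[K]_n -> 'rV[K]_n) :
    Prop :=
  forall x, in_torus x -> exists2 c : K, c != 0 &
    forall i, (F i).@[affine_chart x 0] = c * affine_chart (f x) 0 i.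

Definition has_degree (f : 'rV[K]_n -> 'rV[K]_n) (d : nat) : Prop :=
  exists F : 'I_n.+1 -> {mpoly K[n.+1]},
    [/\ forall i, F i \is d.-homog, no_common_factor F & induces F f].

(* Degree of the rational self-map of P^n induced by f; it is 0 by convention
   when f induces no rational map. *)
Definition degree (f : 'rV[K]_n -> 'rV[K]_n) : nat :=
  xget 0%N [set d | has_degree f d]%classic.

End RationalMaps.

Section Jordan.
Variable K : fieldType.

Definition jordan_block (m : nat) (lam : K) : 'M[K]_m :=
  \matrix_(i, j) (lam *+ (i == j) + (i.+1 == j :> nat)%:R).

(* The Jordan matrix has size \sum_i size_ i, which is only provably equal to n;
   the base change matrix and its inverse P, Q are therefore rectangular. *)
Definition is_jordan_form (n : nat) (M : 'M[K]_n) (s : nat)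
    (size_ : 'I_s -> nat) (lam_ : 'I_s -> K) : Prop :=
  (forall i, (0 < size_ i)%N) /\
  exists (P : 'M[K]_(n, \sum_i size_ i)) (Q : 'M[K]_(\sum_i size_ i, n)),
    [/\ P *m Q = 1%:M, Q *m P = 1%:M &
        Q *m M *m P = \mxdiag_i jordan_block (size_ i) (lam_ i)].

Definition has_jordan_block (n : nat) (M : 'M[K]_n) (m : nat) (lam : K) : Prop :=
  exists s (size_ : 'I_s -> nat) (lam_ : 'I_s -> K),
    is_jordan_form M size_ lam_ /\ exists i, size_ i = m /\ lam_ i = lam.

End Jordan.

Section IntegerMatrices.
Variables (R : realType) (n : nat) (A : 'M[int]_n).
Local Open Scope complex_scope.

Definition complex_mx : 'M[R[i]]_n := map_mx intr A.

Definition spectral_radius : R :=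
  sup [set Normc.normc z | z in [set z | eigenvalue complex_mx z]]%classic.

Definition largest_dominant_jordan_block (m : nat) : Prop :=
  (exists2 lam : R[i], Normc.normc lam = spectral_radius &
     has_jordan_block complex_mx m lam) /\
  (forall (m' : nat) (lam : R[i]), Normc.normc lam = spectral_radius ->
     has_jordan_block complex_mx m' lam -> (m' <= m)%N).

(* The k-th iterate of f_A is taken as a self-map of the torus, which f_A
   preserves. *)
Definition degree_iter (k : nat) : nat :=
  degree (iter k (monomial_map (K := R[i]) A)).

Definition degree_bounds (C0 C1 : R) (l : nat) : Prop :=
  forall k : nat, (0 < k)%N ->
    C0 * k%:R ^+ l * spectral_radius ^+ k <= (degree_iter k)%:R
      <= C1 * k%:R ^+ l * spectral_radius ^+ k.

End IntegerMatrices.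

(* Main.v *)
Require Import Defs.
From mathcomp Require Import all_boot all_order all_algebra.
From mathcomp Require Import boolp classical_sets reals.
From mathcomp Require Import complex mpoly.
From mathcomp Require Import zify ring lra.

(** The statement splits into an exact formula for the degree of a monomial map
    and an estimate of the size of the powers of a matrix.

    Degree. Homogenizing [f_B] and clearing denominators gives the monomials
    with exponents [p_v + e_iv], where [e] is the exponent matrix in homogeneous
    coordinates (its rows sum to zero) and [p_v], the largest of the [- e_iv],
    is the order of the pole along the coordinate hyperplane [v]. Each variable
    is absent from one of these monomials, so they have no common factor
    ([monomials_no_common_factor]), and any other coprime homogeneous family
    inducing [f_B] is a unit times this one ([proportional_to_monomials]). Hence
    the degree is the sum of the [p_v] ([degree_monomial_map]). Since every
    [e_iv] is at least [- p_v] and each row of [e] sums to zero, this number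
    bounds every entry of [B] in absolute value ([entry_le_degree]), and
    conversely it is at most twice the sum of these absolute values
    ([degree_le_entries]).
    As the iterate [f_A^k] is [f_(A^k)], its degree is comparable to any norm of
    [A^k].

    Powers. Over an algebraically closed field a Jordan form exists
    ([exists_jordan_form]): among the families of Jordan chains that span the
    space, one of minimal total length is a basis. The powers of the matrix
    are combinations of powers of Jordan blocks, whose entries are the
    ['C(k, d) * lam ^ (k - d)] with [d] smaller than the size of the block. The
    blocks with [|lam|] maximal and size at most [l + 1] contribute at most a
    multiple of [k ^ l * rho ^ k], and the others are exponentially smaller
    ([dominated_powers]); the corner and a diagonal entry of a block of size
    [l + 1] give the lower bound ([dominated_corner]).

    Uniqueness of [l], and the fact that no Jordan form has a larger dominant
    block, both follow from these two estimates, because [k ^ l * rho ^ k] is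
    bounded by a multiple of [k ^ l' * rho ^ k] only if [l <= l']
    ([dominated_exponent]). *)

Set Implicit Arguments.
Unset Strict Implicit.
Unset Printing Implicit Defensive.

Import Order.TTheory GRing.Theory Num.Theory.
Local Open Scope ring_scope.

(** * Polynomials on the torus and coprime monomials *)

Lemma digits_inj (N n : nat) (a b : 'I_n -> nat) :
  (forall j, a j < N)%N -> (forall j, b j < N)%N ->
  (\sum_j a j * N ^ j)%N = (\sum_j b j * N ^ j)%N -> a =1 b.
Proof.
elim: n a b => [|n IHn] a b ltaN ltbN; first by move=> _ [].
have split_digit (c : 'I_n.+1 -> nat) : (\sum_j c j * N ^ j =
    (\sum_(j < n) c (lift ord0 j) * N ^ j) * N + c ord0)%N.
  rewrite big_ord_recl /= expn0 muln1 addnC big_distrl /=; congr (_ + _)%N.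
  by apply: eq_bigr => j _; rewrite /bump /= expnSr mulnA.
have N_gt0 : (0 < N)%N by apply: leq_ltn_trans (ltaN ord0).
rewrite !split_digit => eqab.
have eq0 : a ord0 = b ord0.
  by move/(congr1 (modn^~ N)): eqab; rewrite !modnMDl !modn_small.
move: eqab; rewrite eq0 => /addIn /eqP; rewrite eqn_pmul2r // => /eqP eqS.
move=> i; case: (unliftP ord0 i) => [j|] -> //.
by apply: (IHn _ _ _ _ eqS) => k.
Qed.

Lemma size_factor1 (D : idomainType) (p q : {poly D}) :
  size (p * q) = 1%N -> size p = 1%N.
Proof.
have [->|p0] := eqVneq p 0; first by rewrite mul0r size_poly0.
have [->|q0] := eqVneq q 0; first by rewrite mulr0 size_poly0.
rewrite size_mul // (polySpred p0) (polySpred q0) addSn addnS /=.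
by case=> /eqP; rewrite addn_eq0 => /andP[/eqP -> _].
Qed.

Section Degree.
Variables (K : closedFieldType) (n : nat).
Implicit Types (x : 'rV[K]_n) (v : 'I_n.+1).

Lemma affine_chart0 x : affine_chart x 0 ord0 = 1.
Proof.
have -> : ord0 = @lshift 1 n 0 by apply/val_inj.
by rewrite [LHS]row_mxEl mxE eqxx.
Qed.

Lemma affine_chartS x j : affine_chart x 0 (lift ord0 j) = x 0 j.
Proof.
have -> : lift ord0 j = @rshift 1 n j by apply/val_inj.
by rewrite [LHS]row_mxEr.
Qed.

(** Kronecker's substitution: on the curve [x_j = t ^ (d.+1 ^ j)] the monomials
    of degree [d] become distinct powers of [t], by uniqueness of base [d.+1]
    digits. Setting the coordinate of index [0] to [1] loses nothing, its
    exponent being determined by the others and the degree. *)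
Lemma homog_vanishes_on_torus d (p : {mpoly K[n.+1]}) : p \is d.-homog ->
  (forall x, in_torus x -> p.@[affine_chart x 0] = 0) -> p = 0.
Proof.
move=> /dhomogP homp' vanp.
have homp : {in msupp p, forall m, mdeg m = d} by [].
pose e (m : 'X_{1..n.+1}) := (\sum_(j < n) m (lift ord0 j) * d.+1 ^ j)%N.
pose q : {poly K} := \sum_(m <- msupp p) p@_m *: 'X^(e m).
have ltd m : m \in msupp p -> forall v, (m v < d.+1)%N.
  move=> /homp <- v; rewrite ltnS mdegE (bigD1 v) //=; exact: leq_addr.
have e_inj : {in msupp p &, injective e}.
  move=> m m' mp m'p eqe; apply/mnmP => v.
  have eqS j : m (lift ord0 j) = m' (lift ord0 j).
    by apply: (digits_inj _ _ eqe) => k; apply: ltd.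
  case: (unliftP ord0 v) => [j|] -> //.
  have := homp _ m'p; rewrite -(homp _ mp) !mdegE !big_ord_recl.
  by rewrite (eq_bigr _ (fun j _ => eqS j)) => /addIn.
have coefq m : m \in msupp p -> q`_(e m) = p@_m.
  move=> mp; rewrite /q coef_sum (bigD1_seq m) ?msupp_uniq //= coefZ coefXn.
  rewrite eqxx mulr1 big_seq_cond big1 ?addr0 // => m' /andP[m'p neq].
  rewrite coefZ coefXn (inj_in_eq e_inj) // eq_sym (negPf neq) mulr0 //.
have vanq t : t != 0 -> q.[t] = 0.
  move=> t_neq0; pose x : 'rV[K]_n := \row_j t ^+ (d.+1 ^ j).
  rewrite -(vanp x); last by move=> j; rewrite mxE expf_neq0.
  rewrite mevalE /q horner_sum; apply: eq_bigr => m _.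
  rewrite hornerZ hornerXn; congr (_ * _).
  rewrite big_ord_recl affine_chart0 expr1n mul1r -prodrXr.
  by apply: eq_bigr => j _; rewrite affine_chartS mxE -exprM mulnC.
have q0 : q = 0.
  apply/eqP; apply: contraT => q_neq0.
  have /closed_nonrootP[t] : q * 'X != 0 by rewrite mulf_neq0 ?polyX_eq0.
  rewrite rootE hornerM hornerX.
  by have [->|/vanq ->] := eqVneq t 0; rewrite ?mulr0 ?mul0r eqxx.
apply/mpolyP => m; rewrite mcoeff0.
have [mp|/memN_msupp_eq0 //] := boolP (m \in msupp p).
by rewrite -coefq // q0 coef0.
Qed.

(** The coefficient of ['X^k] collects the monomials of [p] of degree [k] in the
    variable [v]. This turns the degree in [v] into the degree of a univariate
    polynomial over a domain, which is additive. *)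
Definition grade v (p : {mpoly K[n.+1]}) : {poly {mpoly K[n.+1]}} :=
  mmap (polyC \o @mpolyC n.+1 K)
    (fun u => if u == v then 'X_u *: 'X else ('X_u)%:P) p.

Lemma gradeX v (m : 'X_{1..n.+1}) : grade v 'X_[m] = 'X_[m] *: 'X^(m v).
Proof.
rewrite /grade mmapX /mmap1 (bigD1 v) //= eqxx exprZn.
under eq_bigr => u /negPf -> do rewrite -rmorphXn.
rewrite -rmorph_prod /= mulrC mul_polyC scalerA mulrC.
by rewrite [in RHS]mpolyXE_id [in RHS](bigD1 v).
Qed.

Lemma gradeM v : {morph grade v : p q / p * q}.
Proof. by move=> p q; apply: rmorphM. Qed.

Lemma coef_grade v p k m : ((grade v p)`_k)@_m = p@_m *+ (m v == k).
Proof.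
rewrite [p in LHS]mpolyE /grade raddf_sum /= coef_sum raddf_sum /=.
rewrite (eq_bigr (fun m' => p@_m' * (m' == m)%:R *+ (m v == k))).
  rewrite sumrMnl; congr (_ *+ _).
  rewrite [in RHS](mpolyE p) raddf_sum /=.
  by apply: eq_bigr => m' _; rewrite mcoeffZ mcoeffX.
move=> m' _; rewrite mmapZ -/(grade v _) gradeX /= coefCM coefZ coefXn.
rewrite mcoeffCM mulr_natr raddfMn /= mcoeffX.
have [->|_] := eqVneq m' m; last by rewrite mul0rn !mulr0 mul0rn.
by rewrite eq_sym mulr1 mulr_natr.
Qed.

Lemma mcoeff_divisor_monomial v (g h : {mpoly K[n.+1]}) (m k : 'X_{1..n.+1}) :
  'X_[m] = g * h -> m v = 0%N -> k v != 0%N -> g@_k = 0.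
Proof.
move=> eqgh mv0 kv.
have size_grade : size (grade v g) = 1%N.
  have : size (grade v g * grade v h) = 1%N.
    rewrite -gradeM -eqgh gradeX mv0 expr0 alg_polyC.
    by rewrite size_polyC -msize_poly_eq0 msizeX.
  exact: size_factor1.
have := coef_grade v g (k v) k; rewrite eqxx mulr1n => <-.
by rewrite nth_default ?mcoeff0 // size_grade lt0n.
Qed.

Lemma mem_monomial_ideal (m : 'X_{1..n.+1}) (p : {mpoly K[n.+1]}) :
  {in msupp p, forall k, (m <= k)%MM} -> exists h, p = 'X_[m] * h.
Proof.
move=> lemp; exists (\sum_(k <- msupp p) p@_k *: 'X_[k - m]).
rewrite mulr_sumr [LHS]mpolyE !big_seq; apply: eq_bigr => k /lemp lemk.
by rewrite -scalerAr -mpolyXD addmC submK.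
Qed.

Section MonomialFamily.
Variables (I : finType) (m_ : I -> 'X_{1..n.+1}).
(** This makes the monomials coprime. *)
Hypothesis min_m : forall v, exists i, m_ i v = 0%N.

(** Some monomial of the family omits [v], hence so does any common divisor; a
    polynomial that omits every variable is a constant. *)
Lemma monomials_no_common_factor (g : {mpoly K[n.+1]}) :
  (forall i, exists h, 'X_[m_ i] = g * h) -> g \is a GRing.unit.
Proof.
move=> divg.
have g_const k : k != 0%MM -> g@_k = 0.
  move=> k_neq0; have [v kv] : exists v, k v != 0%N.
    apply/existsP; apply: contraNT k_neq0 => /existsPn k0.
    by apply/eqP/mnmP => v; rewrite mnm0E; apply/eqP; rewrite -[_ == _]negbK.
  have [i miv] := min_m v; have [h eqgh] := divg i.
  exact: mcoeff_divisor_monomial eqgh miv kv.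
have gE : g = (g@_0)%:MP.
  apply/mpolyP => k; rewrite mcoeffC eq_sym.
  by have [->|/g_const ->] := eqVneq k 0%MM; rewrite ?mulr1 ?mulr0.
have [i _] := min_m ord0; have [h eqgh] := divg i.
have g_neq0 : g@_0 != 0.
  apply/eqP => g0; move: eqgh; rewrite gE g0 mpolyC0 mul0r => /eqP.
  by rewrite -msize_poly_eq0 msizeX.
rewrite gE; apply/unitrP; exists (g@_0)^-1%:MP.
by rewrite -!mpolyCM mulVf ?mulfV.
Qed.

(** Unique factorization, in the only case needed: for [j] such that ['X_[m_ j]]
    omits [v], the relation forces every monomial of [G i] to have at least the
    exponent of ['X_[m_ i]] in [v]. *)
Lemma proportional_to_monomials (G : I -> {mpoly K[n.+1]}) :
  (forall i j, 'X_[m_ j] * G i = 'X_[m_ i] * G j) ->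
  (0 < #|I|)%N -> exists H, forall i, G i = 'X_[m_ i] * H.
Proof.
move=> propG /card_gt0P[i0 _].
have [|H GH] := @mem_monomial_ideal (m_ i0) (G i0).
  move=> k kG; apply/mnm_lepP => v; have [j mjv] := min_m v.
  have : (m_ j + k)%MM \in msupp (G i0 * 'X_[m_ j]).
    by rewrite (perm_mem (msuppMX _ _)) map_f.
  rewrite mulrC propG mulrC (perm_mem (msuppMX _ _)) => /mapP[k' _ /mnmP/(_ v)].
  by rewrite !mnmDE mjv add0n => ->; apply: leq_addr.
exists H => i; apply: (@mulfI _ 'X_[m_ i0]).
  by rewrite -msize_poly_eq0 msizeX.
by rewrite propG GH mulrCA.
Qed.

End MonomialFamily.

End Degree.

(** * The degree of a monomial map *)

Definition negpart (z : int) : nat := if z is Negz k then k.+1 else 0%N.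

Section MonomialDegree.
Variable n : nat.
Implicit Types (B : 'M[int]_n) (i v : 'I_n.+1).

(** Exponents of the Laurent monomials of degree zero in the homogeneous
    coordinates: row [0] is the constant coordinate, and the exponent of the
    variable of index [0] makes each row sum to zero. *)
Definition hom_exponent B i v : int :=
  if unlift ord0 i is Some i' then
    if unlift ord0 v is Some j then B i' j else - \sum_j B i' j
  else 0.

(** The order of the pole along the hyperplane of index [v], as the row [0] of
    exponents is zero. *)
Definition pole_order B v : nat := \max_i negpart (hom_exponent B i v).

Definition monomial_degree B : nat := \sum_v pole_order B v.

Definition monomial B i : 'X_{1..n.+1} :=
  [multinom absz ((pole_order B v)%:Z + hom_exponent B i v)%R | v < n.+1].

Lemma negpart_ge0 (z : int) (d : nat) :
  (negpart z <= d)%N -> 0 <= d%:Z + z.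
Proof. by case: z => k /=; lia. Qed.

Lemma monomialE B i v :
  (monomial B i v)%:Z = (pole_order B v)%:Z + hom_exponent B i v.
Proof.
rewrite mnmE abszE ger0_norm // negpart_ge0 //.
exact: (@leq_bigmax _ (fun i => negpart (hom_exponent B i v)) i).
Qed.

Lemma sum_hom_exponent B i : \sum_v hom_exponent B i v = 0.
Proof.
case: (unliftP ord0 i) => [i'|] ->; rewrite /hom_exponent.
  rewrite big_ord_recl liftK unlift_none; set s := (X in _ + X).
  suff -> : s = \sum_j B i' j by rewrite addNr.
  by apply: eq_bigr => j _; rewrite liftK.
by rewrite unlift_none big1.
Qed.

Lemma mdeg_monomial B i : mdeg (monomial B i) = monomial_degree B.
Proof.
apply/eqP; rewrite -eqz_nat mdegE /monomial_degree -!natz !natr_sum.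
rewrite -subr_eq0 -sumrB; apply/eqP; rewrite -[RHS](sum_hom_exponent B i).
by apply: eq_bigr => v _; rewrite !natz monomialE addrAC subrr add0r.
Qed.

Lemma monomial_min B v : exists i, monomial B i v = 0%N.
Proof.
have [|i poleE] := @bigop.eq_bigmax _ (fun i => negpart (hom_exponent B i v)).
  by rewrite card_ord.
rewrite -/(pole_order B v) in poleE.
have := monomialE B i v; rewrite poleE.
case E: (hom_exponent B i v) => [k|k] /=; last first.
  by exists i; lia.
exists ord0; apply/eqP; rewrite -eqz_nat monomialE poleE E.
by rewrite /hom_exponent unlift_none.
Qed.

Section OverField.
Variable K : closedFieldType.
Implicit Types (x : 'rV[K]_n).

Lemma affine_chart_neq0 x v : in_torus x -> affine_chart x 0 v != 0.
Proof.
move=> tx; case: (unliftP ord0 v) => [j|] ->.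
  by rewrite affine_chartS.
by rewrite affine_chart0 oner_neq0.
Qed.

Lemma prod_exprz_sum (I : finType) (P : pred I) (F : I -> int) (a : K) :
  a != 0 -> \prod_(i | P i) a ^ F i = a ^ (\sum_(i | P i) F i).
Proof.
move=> a0; apply/esym/(big_morph _ (fun m k => expfzDr m k a0)).
exact: expr0z.
Qed.

Lemma affine_chart_monomial_map B x i : in_torus x ->
  affine_chart (monomial_map B x) 0 i =
  \prod_v affine_chart x 0 v ^ hom_exponent B i v.
Proof.
move=> tx; rewrite /hom_exponent; case: (unliftP ord0 i) => [i'|] ->.
  rewrite affine_chartS mxE big_ord_recl affine_chart0 exp1rz mul1r.
  by apply: eq_bigr => j _; rewrite affine_chartS liftK.
by rewrite affine_chart0 big1.
Qed.

Lemma meval_monomial B x i : in_torus x ->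
  ('X_[monomial B i] : {mpoly K[n.+1]}).@[affine_chart x 0] =
  (\prod_v affine_chart x 0 v ^+ pole_order B v) *
    affine_chart (monomial_map B x) 0 i.
Proof.
move=> tx; rewrite affine_chart_monomial_map // -big_split mevalX.
apply: eq_bigr => v _; rewrite /= [LHS]exprnP monomialE.
by rewrite expfzDr // affine_chart_neq0.
Qed.

(** Only the values of [f] on the torus are constrained: an iterate of a
    monomial map agrees with a monomial map there, but not necessarily where a
    coordinate vanishes. *)
Lemma has_degree_monomial_map B (f : 'rV[K]_n -> 'rV[K]_n) d :
  (forall x, in_torus x -> f x = monomial_map B x) ->
  has_degree f d <-> d = monomial_degree B.
Proof.
move=> fE.
have homX i : 'X_[monomial B i] \is [in K[n.+1], (monomial_degree B).-homog].
  by rewrite dhomogX; apply/eqP/mdeg_monomial.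
split=> [[G [homG gcdG indG]]|->].
  have propG i j : 'X_[monomial B j] * G i = 'X_[monomial B i] * G j.
    apply/eqP; rewrite -subr_eq0; apply/eqP.
    apply: (@homog_vanishes_on_torus _ _ (monomial_degree B + d)).
      by rewrite rpredB // dhomogM.
    move=> x tx; have [c _ GE] := indG x tx.
    rewrite mevalB !mevalM !GE fE // !meval_monomial //; ring.
  have [|H GH] := proportional_to_monomials (monomial_min B) propG.
    by rewrite card_ord.
  have /unitrP[H' [HH' _]] : H \is a GRing.unit.
    by apply: gcdG => i; exists 'X_[monomial B i]; rewrite GH mulrC.
  have H0 : H != 0.
    by apply/eqP => H0; move/eqP: HH'; rewrite H0 mulr0 eq_sym oner_eq0.
  have homH : H \is [in K[n.+1], 0.-homog].
    have /andP[/eqP -> _] := mpoly_intro_unit HH'.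
    by rewrite dhomogE msuppC; case: ifP => //= _; rewrite mdeg0.
  apply: (@dhomog_uniq _ _ mdeg (G ord0)) (homG ord0) _.
    by rewrite GH mulf_neq0 // -msize_poly_eq0 msizeX.
  by rewrite GH -[monomial_degree B]addn0 dhomogM.
exists (fun i => 'X_[monomial B i]); split.
- exact: homX.
- by move=> g; apply: monomials_no_common_factor; apply: monomial_min.
move=> x tx; exists (\prod_v affine_chart x 0 v ^+ pole_order B v).
  by apply/prodf_neq0 => v _; rewrite expf_neq0 // affine_chart_neq0.
by move=> i; rewrite meval_monomial // fE.
Qed.

Lemma degree_monomial_map B (f : 'rV[K]_n -> 'rV[K]_n) :
  (forall x, in_torus x -> f x = monomial_map B x) ->
  degree f = monomial_degree B.
Proof.
move=> fE; rewrite /degree; apply: xget_unique => [|d].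
  exact/(has_degree_monomial_map _ fE).
by move/(has_degree_monomial_map _ fE).
Qed.

Lemma monomial_map_comp A B x : in_torus x ->
  monomial_map A (monomial_map B x) = monomial_map (A *m B) x.
Proof.
move=> tx; apply/rowP => i; rewrite !mxE.
under [RHS]eq_bigr => l _ do rewrite mxE -prod_exprz_sum //.
rewrite exchange_big; apply: eq_bigr => j _ /=; rewrite mxE.
rewrite (big_morph (fun z => z ^ A i j) (fun a b => expfzMl a b _)
  (exp1rz _ _)).
by apply: eq_bigr => l _; rewrite exprz_exp mulrC.
Qed.

Lemma iter_monomial_map A k x : in_torus x ->
  iter k (monomial_map A) x = monomial_map (A ^+ k) x.
Proof.
move=> tx; elim: k => [|k IHk].
  apply/rowP => i; rewrite expr0 mxE (bigD1 i) //= mxE eqxx expr1z.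
  rewrite big1 ?mulr1 // => j.
  by rewrite mxE eq_sym => /negPf ->; rewrite expr0z.
by rewrite iterS IHk monomial_map_comp // exprS.
Qed.

Lemma degree_iter_monomial_map A k :
  degree (iter k (monomial_map (K := K) A)) = monomial_degree (A ^+ k).
Proof. by apply: degree_monomial_map => x; apply: iter_monomial_map. Qed.

End OverField.

(** The entries of [B] are themselves exponents of the homogenized monomials,
    and these sum to zero along each row, so the poles control the zeros. *)
Lemma entry_le_degree B (i j : 'I_n) : (absz (B i j) <= monomial_degree B)%N.
Proof.
pose z v := hom_exponent B (lift ord0 i) v.
have poleP v : - (pole_order B v)%:Z <= z v.
  have := @leq_bigmax _ (fun i => negpart (hom_exponent B i v)) (lift ord0 i).
  by move/negpart_ge0; rewrite -lerBlDl sub0r.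
have zE : z (lift ord0 j) = B i j by rewrite /z /hom_exponent !liftK.
have le_pole : (pole_order B (lift ord0 j) <= monomial_degree B)%N.
  by rewrite /monomial_degree (bigD1 (lift ord0 j)) //= leq_addr.
have lower := poleP (lift ord0 j).
have zsum : z (lift ord0 j) = \sum_(v | v != lift ord0 j) - z v.
  rewrite sumrN; apply/eqP; rewrite -addr_eq0.
  have := sum_hom_exponent B (lift ord0 i).
  by rewrite (bigD1 (lift ord0 j)) //= => /eqP.
have le_sum : \sum_(v | v != lift ord0 j) - z v <=
    \sum_(v | v != lift ord0 j) (pole_order B v)%:Z.
  by apply: ler_sum => v _; rewrite lerNl.
have degE : (monomial_degree B)%:Z = (pole_order B (lift ord0 j))%:Z +
    \sum_(v | v != lift ord0 j) (pole_order B v)%:Z.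
  rewrite -natz /monomial_degree natr_sum (bigD1 (lift ord0 j)) //= natz.
  by congr (_ + _); apply: eq_bigr => v _; rewrite natz.
rewrite zE in lower zsum; lia.
Qed.

(** The factor [2] comes from the exponent of index [0], which is the sum of the
    row up to sign. *)
Lemma degree_le_entries B :
  (monomial_degree B <= 2 * \sum_i \sum_j absz (B i j))%N.
Proof.
have neg_abs z : (negpart z <= absz z)%N by case: z.
have pole_le v : (pole_order B v <= \sum_i absz (hom_exponent B i v))%N.
  apply/bigmax_leqP => i _; apply: leq_trans (neg_abs _) _.
  by rewrite (bigD1 i) //= leq_addr.
apply: leq_trans (leq_sum _ (fun v _ => pole_le v)) _.
rewrite exchange_big /= big_ord_recl big1 ?add0n; last first.
  by move=> v _; rewrite /hom_exponent unlift_none.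
rewrite mulSn mul1n -big_split; apply: leq_sum => i _ /=.
rewrite big_ord_recl leq_add //; last first.
  by apply: leq_sum => j _; rewrite /hom_exponent !liftK.
rewrite /hom_exponent liftK unlift_none abszN.
apply: (big_ind2 (fun (a : int) b => absz a <= b)%N) => // a b c d; lia.
Qed.

End MonomialDegree.

(** * Existence of Jordan forms *)

Section JordanBlocks.
Variable K : fieldType.

Lemma jordan_blockE m (lam : K) a b :
  jordan_block m lam a b = lam *+ (a == b) + (a.+1 == b :> nat)%:R.
Proof. by rewrite mxE. Qed.

Lemma mul_jordan_block (m p : nat) lam (X : 'M[K]_(m, p)) a :
  row a (jordan_block m lam *m X) =
  lam *: row a X + \sum_(b < m | b == a.+1 :> nat) row b X.
Proof.
apply/rowP => c; rewrite !mxE summxE [in RHS]big_mkcond.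
under [LHS]eq_bigr => b _ do rewrite jordan_blockE mulrDl.
rewrite big_split /=; congr (_ + _); last first.
  apply: eq_bigr => b _; rewrite eq_sym.
  by case: eqP; rewrite ?mul1r ?mul0r ?mxE.
rewrite (bigD1 a) //= eqxx mulr1n big1 ?addr0 // => b.
by rewrite eq_sym => /negPf ->; rewrite mulr0n mul0r.
Qed.

(** In coordinates, the equation says [(a - lam) * w_b = w_(b - 1)], with zero
    on the right for [b = 0]. *)
Lemma jordan_block_eigenvector (m : nat) (lam a : K) (w : 'rV_m) :
  w *m jordan_block m lam = a *: w -> w != 0 ->
  a = lam /\ forall b : 'I_m, (b.+1 < m)%N -> w 0 b = 0.
Proof.
move=> /rowP wJ w0.
have wE (b : 'I_m) : (a - lam) * w 0 b = \sum_(c < m | c.+1 == b :> nat) w 0 c.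
  have := wJ b; rewrite !mxE [in X in _ -> _ = X]big_mkcond mulrBl => <-.
  under [X in X - _]eq_bigr => c _ do rewrite jordan_blockE mulrDr.
  rewrite big_split /= (bigD1 b) //= eqxx mulr1n.
  rewrite [X in _ + X + _ - _]big1 => [|c /negPf ->]; last first.
    by rewrite mulr0n mulr0.
  rewrite addr0 mulrC addrAC subrr add0r; apply: eq_bigr => c _.
  by case: eqP; rewrite ?mulr1 ?mulr0.
have alam : a = lam.
  apply/eqP; apply: contraNT w0; rewrite -subr_eq0 => alam.
  apply/eqP/rowP => b; rewrite mxE; have [k] := ubnP b.
  elim: k b => // k IHk b ltb; apply/(mulfI alam).
  by rewrite wE mulr0 big1 // => c /eqP cb; apply: IHk; lia.
split=> // b ltb; have := wE (Ordinal ltb).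
rewrite alam subrr mul0r (bigD1 b) //= big1 ?addr0 => [<- //|c].
by rewrite eqSS => /andP[/eqP cb /negP[]]; apply/eqP/val_inj.
Qed.

Lemma submx_mxcol (s n : nat) (m_ : 'I_s -> nat)
    (B_ : forall i, 'M[K]_(m_ i, n)) i : (B_ i <= \mxcol_i B_ i)%MS.
Proof. by rewrite -[X in (X <= _)%MS](mxcolK B_); apply: rowsub_sub. Qed.

End JordanBlocks.

Lemma invariant_eigenvector (K : closedFieldType) (m n : nat)
    (J : 'M[K]_m) (V : 'M[K]_(n, m)) : stablemx V J -> V != 0 ->
  exists2 u : 'rV_m, (u <= V)%MS /\ u != 0 & exists a, u *m J = a *: u.
Proof.
move=> stabV V0.
have stabB : stablemx (row_base V) J by rewrite stablemx_row_base.
have /closed_rootP[a] : size (char_poly (restrictmx V J)) != 1%N.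
  by rewrite size_char_poly eqSS mxrank_eq0.
rewrite -eigenvalue_root_char => /eigenvalueP[w wJ w0].
exists (w *m row_base V); first split.
- by rewrite -(eq_row_base V) submxMl.
- by rewrite mulmx_free_eq0 ?row_base_free.
exists a; rewrite -mulmxA -[row_base V *m J](mulmxKpV stabB) mulmxA.
by rewrite [w *m _]wJ scalemxAl.
Qed.

Section Jordan.
Variables (K : closedFieldType) (n : nat) (M : 'M[K]_n).

(** Rows run from the start of the chain to its end, so that [M] on the right
    acts as an upper triangular Jordan block on the left. *)
Definition jordan_chain (m : nat) (lam : K) (q : 'rV[K]_n) : 'M[K]_(m, n) :=
  \matrix_(a < m) (q *m (M - lam%:M) ^+ a).

Lemma jordan_chainM m lam q : q *m (M - lam%:M) ^+ m = 0 ->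
  jordan_chain m lam q *m M = jordan_block m lam *m jordan_chain m lam q.
Proof.
move=> qm0; apply/row_matrixP => a; rewrite mul_jordan_block row_mul !rowK.
rewrite -[X in _ *m X = _](subrK lam%:M) mulmxDr mul_mx_scalar addrC.
congr (_ + _); rewrite -mulmxA mulmxE -exprSr.
have [lta|] := ltnP a.+1 m; last first.
  move=> lema; have -> : a.+1 = m by apply/eqP; rewrite eqn_leq lema ltn_ord.
  by rewrite qm0 big1 // => b /eqP E; have := ltn_ord b; rewrite E ltnn.
rewrite (bigD1 (Ordinal lta)) //= rowK big1 ?addr0 // => b /andP[/eqP E].
by move=> /negP[]; apply/eqP/val_inj.
Qed.

(** The exponent [a] is unbounded because the vectors with [m_ i <= a] vanish.
    Spanning is expressed through the subspaces [W] containing the chains, so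
    that the index type is arbitrary and no block matrix has to be rebuilt when
    a chain changes. *)
Definition spanning_chains (I : finType) (m_ : I -> nat) (lam_ : I -> K)
    (q_ : I -> 'rV[K]_n) : Prop :=
  (forall i, q_ i *m (M - (lam_ i)%:M) ^+ m_ i = 0) /\
  forall k (W : 'M[K]_(k, n)),
    (forall i a, (q_ i *m (M - (lam_ i)%:M) ^+ a <= W)%MS) -> row_full W.

(** Chains of length zero consist of a null vector and can be dropped. *)
Lemma reindex_spanning_chains (I : finType) m_ lam_ q_ :
  @spanning_chains I m_ lam_ q_ -> exists s mu_ lam'_ q'_,
  [/\ @spanning_chains 'I_s mu_ lam'_ q'_, forall i, (0 < mu_ i)%N &
      (\sum_i mu_ i = \sum_i m_ i)%N].
Proof.
case=> nilq spanq; pose P := [pred i | (0 < m_ i)%N].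
pose f (i : 'I_#|P|) : I := enum_val i.
exists #|P|, (m_ \o f), (lam_ \o f), (q_ \o f); split.
- split=> [i|k W subW]; first exact: nilq.
  apply: spanq => i a; have [Pi|] := boolP (i \in P).
    by have := subW (enum_rank_in Pi i) a; rewrite /= /f enum_rankK_in.
  rewrite inE -eqn0Ngt => /eqP mi0; have := nilq i.
  by rewrite mi0 expr0 mulmx1 => ->; rewrite mul0mx sub0mx.
- by move=> i; have := enum_valP i.
rewrite [RHS](bigID P) /= [X in (_ + X)%N]big1 ?addn0 => [|i].
  by rewrite [RHS](big_enum_val (A := P)).
by rewrite -eqn0Ngt => /eqP.
Qed.

Lemma spanning_row_full s m_ lam_ q_ : @spanning_chains 'I_s m_ lam_ q_ ->
  row_full (\mxcol_i jordan_chain (m_ i) (lam_ i) (q_ i)).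
Proof.
case=> nilq; apply=> i a; have [lta|lea] := ltnP a (m_ i); last first.
  by rewrite -(subnKC lea) exprD -mulmxE mulmxA nilq mul0mx sub0mx.
pose B_ j := jordan_chain (m_ j) (lam_ j) (q_ j).
apply: submx_trans (submx_mxcol B_ i).
apply: (eq_row_sub (Ordinal lta)); exact: rowK.
Qed.

(** Only the last coordinate of [w] is nonzero. It is written as the sum of the
    coordinates, which makes sense for chains of length zero too. *)
Lemma sum_eigen_chain m lam q (w : 'rV_m) (a : K) :
  w *m jordan_block m lam = a *: w ->
  w *m jordan_chain m lam q =
  (\sum_b w 0 b) *: (q *m (M - lam%:M) ^+ m.-1).
Proof.
move=> wJ; have [->|w0] := eqVneq w 0.
  by rewrite mul0mx big1 ?scale0r // => b; rewrite mxE.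
have [_ w_last] := jordan_block_eigenvector wJ w0.
rewrite mulmx_sum_row scaler_suml; apply: eq_bigr => b _; rewrite rowK.
have [ltb|leb] := ltnP b.+1 m; first by rewrite w_last // !scale0r.
by congr (_ *: (_ *m _ ^+ _)); have := ltn_ord b; lia.
Qed.

Lemma eigen_sum_neq0 m lam (w : 'rV[K]_m) (a : K) :
  w *m jordan_block m lam = a *: w -> w != 0 -> \sum_b w 0 b != 0.
Proof.
move=> wJ w0; have [_ w_last] := jordan_block_eigenvector wJ w0.
have [b wb] := rV0Pn _ w0; rewrite (bigD1 b) //= big1 ?addr0 // => c neq_cb.
apply: (w_last c); have := ltn_ord c; rewrite leq_eqVlt => /predU1P[cm|//].
case/negP: neq_cb; have [ltb|leb] := ltnP b.+1 m.
  by rewrite w_last ?eqxx in wb.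
by apply/eqP/val_inj => /=; have := ltn_ord b; lia.
Qed.

(** The linear relations between the vectors of the chains form a subspace that
    is stable under the Jordan matrix [J], as [Q *m M = J *m Q]. An eigenvector
    in it is a relation between the last vectors of some chains with a common
    eigenvalue. The shortest of these chains can then be replaced by a chain
    with one vector less, started at the combination of the [q_ i] and their
    images whose last vector is the one killed by the relation. *)
Lemma shorten_chains s m_ lam_ q_ : @spanning_chains 'I_s m_ lam_ q_ ->
  (n < \sum_i m_ i)%N -> exists mu_ q'_,
  @spanning_chains 'I_s mu_ lam_ q'_ /\ (\sum_i mu_ i < \sum_i m_ i)%N.
Proof.
move=> [nilq spanq] ltn_sum.
pose chain i := jordan_chain (m_ i) (lam_ i) (q_ i).
pose J := \mxdiag_i jordan_block (m_ i) (lam_ i).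
pose Q := \mxcol_i chain i.
have QM : Q *m M = J *m Q.
  rewrite /Q mul_mxdiag_mxcol mxcol_mul.
  by apply: eq_mxcol => i; apply: jordan_chainM.
have kerJ : stablemx (kermx Q) J.
  by apply/sub_kermxP; rewrite -mulmxA -QM mulmxA mulmx_ker mul0mx.
have ker0 : kermx Q != 0.
  rewrite kermx_eq0 /row_free neq_ltn; apply/orP; left.
  exact: leq_ltn_trans (rank_leq_col _) ltn_sum.
have [u [uker u0] [a uJ]] := invariant_eigenvector kerJ ker0.
pose u_ i := submxrow u i.
have uJ_ i : u_ i *m jordan_block (m_ i) (lam_ i) = a *: u_ i.
  move: uJ; rewrite -[in u *m J](submxrowK u) mul_mxrow_mxdiag.
  move/mxrowP/(_ i); rewrite mxrowK => ->.
  by apply/rowP => b; rewrite !mxE.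
pose c_ i := \sum_b u_ i 0 b.
have rel : \sum_i c_ i *: (q_ i *m (M - (lam_ i)%:M) ^+ (m_ i).-1) = 0.
  move/sub_kermxP: uker; rewrite -[u in u *m _]submxrowK mul_mxrow_mxcol.
  move=> uQ0; rewrite -[RHS]uQ0.
  by apply: eq_bigr => i _; rewrite /chain (sum_eigen_chain _ (uJ_ i)).
have [i1 ui1] : exists i, u_ i != 0.
  apply/existsP; apply: contraNT u0 => /existsPn u_0.
  rewrite -[u]submxrowK; apply/eqP/rowP => b; rewrite mxE [RHS]mxE.
  by have /negPn/eqP := u_0 (tagnat.sig1 b); rewrite /u_ => ->; rewrite mxE.
case: (@arg_minnP _ i1 (fun i => u_ i != 0) m_ ui1) => i0 ui0 min_i0.
have lamE i : u_ i != 0 -> lam_ i = lam_ i0.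
  move=> ui; have [<- _] := jordan_block_eigenvector (uJ_ i) ui.
  by have [<- _] := jordan_block_eigenvector (uJ_ i0) ui0.
have m_gt0 i : u_ i != 0 -> (0 < m_ i)%N.
  rewrite lt0n; apply: contraNneq => mi0; apply/eqP/rowP => -[b ltb].
  by exfalso; rewrite mi0 in ltb.
have c0 i : u_ i = 0 -> c_ i = 0.
  by move=> ui; rewrite /c_ ui big1 // => b _; rewrite mxE.
set N := M - (lam_ i0)%:M in rel *.
(* [m_ i0] is minimal, so these exponents are the actual differences. *)
pose p := \sum_(i | u_ i != 0) c_ i *: (q_ i *m N ^+ (m_ i - m_ i0)).
exists (fun i => if i == i0 then (m_ i0).-1 else m_ i),
       (fun i => if i == i0 then p else q_ i); split; last first.
  rewrite (bigD1 i0) //= eqxx [X in (_ < X)%N](bigD1 i0) //=.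
  rewrite (eq_bigr m_) => [|i /negPf -> //].
  by rewrite ltn_add2r prednK // m_gt0.
split=> [i|k W subW].
  case: eqP => [->|_]; last exact: nilq.
  rewrite -/N -[RHS]rel [RHS](bigID (fun i => u_ i != 0)) /=.
  rewrite [X in _ + X]big1 ?addr0; last first.
    by move=> j; rewrite negbK => /eqP/c0 ->; rewrite scale0r.
  rewrite mulmx_suml; apply: eq_bigr => j uj.
  rewrite -scalemxAl lamE // -/N -mulmxA mulmxE -exprD.
  congr (_ *: (_ *m _ ^+ _)).
  by have := m_gt0 _ ui0; have := min_i0 _ uj; lia.
have subW' i e : i != i0 -> (q_ i *m (M - (lam_ i)%:M) ^+ e <= W)%MS.
  by move=> /negPf ii0; have := subW i e; rewrite ii0.
apply: spanq => i e; have [->|] := eqVneq i i0; last exact: subW'.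
(* The coefficient of [q_ i0] in [p] is invertible, so [q_ i0] is recovered. *)
have := subW i0 e; rewrite eqxx -/N /p (bigD1 i0) //= subnn expr0 mulmx1.
rewrite mulmxDl -scalemxAl; set y := (X in _ + X) => pW.
have ci0 : c_ i0 != 0 by apply: eigen_sum_neq0 (uJ_ i0) ui0.
rewrite -[q_ i0 *m _](scalerK ci0) scalemx_sub //.
rewrite -[X in (X <= _)%MS](addrK y) addmx_sub //.
rewrite eqmx_opp /y mulmx_suml summx_sub // => j /andP[uj ji0].
rewrite -scalemxAl scalemx_sub // -mulmxA mulmxE -exprD /N -(lamE _ uj).
exact: subW'.
Qed.

(** Chains can be shortened until their total length is the dimension; they then
    form a basis, in which the matrix is in Jordan form. *)
Lemma exists_jordan_form_of_spanning (I : finType) m_ lam_ q_ :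
  @spanning_chains I m_ lam_ q_ ->
  exists s size_ lam'_, @is_jordan_form K n M s size_ lam'_.
Proof.
have [k] := ubnP (\sum_i m_ i); elim: k I m_ lam_ q_ => // k IHk I m_ lam_ q_.
rewrite ltnS => lek /reindex_spanning_chains[s [mu_ [lam'_ [q'_]]]].
case=> span mu_gt0 sumE.
have [ltn_sum|le_sum] := ltnP n (\sum_i mu_ i).
  have [nu_ [q''_ [span' lt_sum]]] := shorten_chains span ltn_sum.
  by apply: IHk span'; rewrite (leq_trans lt_sum) // sumE.
have fullQ := spanning_row_full span; have [nilq _] := span.
set Q := \mxcol_i _ in fullQ; have freeQ : row_free Q.
  rewrite /row_free eqn_leq rank_leq_row /=.
  by move/eqP: fullQ => ->.
exists s, mu_, lam'_; split=> //; exists (pinvmx Q), Q; split.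
- exact: mulVpmx.
- exact: mulmxVp.
suff -> : Q *m M = \mxdiag_i jordan_block (mu_ i) (lam'_ i) *m Q.
  by rewrite -mulmxA mulmxVp // mulmx1.
rewrite /Q mul_mxdiag_mxcol mxcol_mul.
by apply: eq_mxcol => i; apply: jordan_chainM.
Qed.

End Jordan.

(** By the Cayley-Hamilton theorem the generalized eigenspaces, that is, the
    kernels of the [(M - lam) ^ n], span the space. *)
Lemma spanning_generalized_eigenvectors (K : closedFieldType) (n : nat)
    (M : 'M[K]_n.+1) : exists (I : finType) m_ lam_ q_,
  @spanning_chains K n.+1 M I m_ lam_ q_.
Proof.
have [r charE] := closed_field_poly_normal (char_poly M).
rewrite (monicP (char_poly_monic M)) scale1r in charE.
pose t := undup r; pose lam (j : 'I_(size t)) := t`_j.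
pose N j := M - (lam j)%:M.
exists ('I_(size t) * 'I_n.+1)%type, (fun=> n.+1), (fun i => lam i.1),
  (fun i => row i.2 (kermx (N i.1 ^+ n.+1))); split=> [i|k W subW].
  by rewrite -row_mul -/(N _) mulmx_ker row0.
have kerW j : (geigenspace M (lam j) <= W)%MS.
  rewrite geigenspaceE; apply/row_subP => i.
  by have := subW (j, i) 0; rewrite expr0 mulmx1.
rewrite -sub1mx.
pose p := \prod_(j < size t) (('X - (lam j)%:P) ^+ n.+1).
have /kermxpoly_min ker1 : mxminpoly M %| p.
  apply: dvdp_trans (mxminpoly_dvd_char M) _.
  rewrite charE -prodr_undup_exp_count (big_nth 0) big_mkord.
  apply: (big_ind2 (fun a b => a %| b)) => // [a b c d ab cd|j _].
    exact: dvdp_mul.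
  apply: dvdp_exp2l; apply: leq_trans (count_size _ _) _.
  have := size_char_poly M; rewrite charE size_prod_XsubC.
  by case=> ->.
rewrite -ker1 kermxpoly_prod; first by apply/sumsmx_subP => j _; apply: kerW.
move=> i j _ _ neq_ij; rewrite coprimep_expr // coprimep_expl //.
rewrite coprimep_XsubC root_XsubC nth_uniq ?undup_uniq //.
Qed.

Lemma exists_jordan_form (K : closedFieldType) (n : nat) (M : 'M[K]_n) :
  exists s size_ lam_, @is_jordan_form K n M s size_ lam_.
Proof.
case: n M => [|n] M.
  exists 0, (fun=> 0), (fun=> 0); split=> [[] //|].
  exists 0, 0; split; apply/matrixP => -[i ltin]; exfalso => //.
  - by rewrite big_ord0 in ltin.
  - by rewrite big_ord0 in ltin.
have [I [m_ [lam_ [q_]]]] := spanning_generalized_eigenvectors M.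
exact: exists_jordan_form_of_spanning.
Qed.

(** * Growth of powers of a matrix in Jordan form *)

Lemma bin_le_expn k d : ('C(k, d) <= k ^ d)%N.
Proof.
apply: leq_trans (_ : k ^_ d <= _)%N.
  by rewrite -bin_ffact leq_pmulr ?fact_gt0.
rewrite ffact_prod -[X in (k ^ X)%N]card_ord -prod_nat_const.
by apply: leq_prod => i _; rewrite leq_subr.
Qed.

(** The summand [1] accounts for [k < l], where the binomial vanishes. *)
Lemma expn_le_bin k l : (k ^ l <= l ^ l * (1 + l`! * 'C(k, l)))%N.
Proof.
have [ltkl|lelk] := ltnP k l.
  by rewrite bin_small // muln0 addn0 muln1 leq_exp2r ?(ltnW ltkl) //; lia.
have [->|l_gt0] := posnP l; first by rewrite !expn0; lia.
have base : (k <= l * (k - l.-1))%N by nia.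
apply: leq_trans (_ : (l * (k - l.-1)) ^ l <= _)%N; first by rewrite leq_exp2r.
rewrite expnMn leq_mul2l; apply/orP; right.
rewrite mulnC bin_ffact ffact_prod (leq_trans _ (leq_addl _ _)) //.
rewrite -[X in (_ ^ X <= _)%N](card_ord l) -prod_nat_const.
by apply: leq_prod => i _; have := ltn_ord i; lia.
Qed.

Section Growth.
Variable R : realType.
Local Notation C := (complex R).
Local Notation normc := (@Normc.normc R).

Lemma normc_ge0 (x : C) : 0 <= normc x.
Proof. by case: x => a b; apply: sqrtr_ge0. Qed.

Lemma normcX (x : C) k : normc (x ^+ k) = normc x ^+ k.
Proof.
elim: k => [|k IHk]; first by rewrite !expr0 Normc.normc1.
by rewrite !exprS Normc.normcM IHk.
Qed.

Lemma normc_nat k : normc k%:R = k%:R.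
Proof. by rewrite normcMn Normc.normc1. Qed.

Lemma normc_int (z : int) : normc z%:~R = (absz z)%:R.
Proof.
by case: z => k; rewrite ?NegzE ?mulrNz ?normcN -pmulrn normc_nat.
Qed.

Lemma normc_sum (I : finType) (F : I -> C) :
  normc (\sum_i F i) <= \sum_i normc (F i).
Proof.
apply: (big_ind2 (fun a b => normc a <= b)) => [|a b c d ab cd|//].
  by rewrite Normc.normc0.
by apply: le_trans (le_normcD _ _) (lerD ab cd).
Qed.

Definition mxnorm m p (X : 'M[C]_(m, p)) : R := \sum_i \sum_j normc (X i j).

Lemma mxnorm_ge0 m p (X : 'M[C]_(m, p)) : 0 <= mxnorm X.
Proof.
by rewrite !sumr_ge0 // => i _; rewrite sumr_ge0 // => j _; apply: normc_ge0.
Qed.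

Lemma row_le_mxnorm m p (X : 'M[C]_(m, p)) i :
  \sum_j normc (X i j) <= mxnorm X.
Proof.
rewrite /mxnorm (bigD1 i) //= lerDl sumr_ge0 // => i' _.
by rewrite sumr_ge0 // => j _; apply: normc_ge0.
Qed.

Lemma entry_le_mxnorm m p (X : 'M[C]_(m, p)) i j : normc (X i j) <= mxnorm X.
Proof.
apply: le_trans (row_le_mxnorm X i).
by rewrite (bigD1 j) //= lerDl sumr_ge0 // => j' _; apply: normc_ge0.
Qed.

Lemma mxnormM m p q (X : 'M[C]_(m, p)) (Y : 'M_(p, q)) :
  mxnorm (X *m Y) <= mxnorm X * mxnorm Y.
Proof.
rewrite {1 2}/mxnorm mulr_suml; apply: ler_sum => i _.
apply: le_trans (_ : \sum_j \sum_k normc (X i k) * normc (Y k j) <= _).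
  apply: ler_sum => j _; rewrite mxE; apply: le_trans (normc_sum _) _.
  by apply: ler_sum => k _; rewrite Normc.normcM.
rewrite exchange_big mulr_suml; apply: ler_sum => k _ /=.
by rewrite -mulr_sumr ler_wpM2l ?normc_ge0 ?row_le_mxnorm.
Qed.

Lemma mxnorm_sum (I : finType) m p (X_ : I -> 'M[C]_(m, p)) :
  mxnorm (\sum_i X_ i) <= \sum_i mxnorm (X_ i).
Proof.
rewrite /mxnorm [leRHS]exchange_big; apply: ler_sum => i _ /=.
rewrite [leRHS]exchange_big; apply: ler_sum => j _ /=.
by rewrite summxE normc_sum.
Qed.

(** Constants are uniform over the positive integers only: at [0] the
    comparison function [k ^+ l * rho ^+ k] vanishes as soon as [0 < l]. *)
Definition dominated (F G : nat -> R) : Prop :=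
  exists2 c, 0 <= c & forall k, (0 < k)%N -> F k <= c * G k.

Lemma dominated_trans F G H : dominated F G -> dominated G H -> dominated F H.
Proof.
move=> [c c0 FG] [d d0 GH]; exists (c * d) => [|k k0]; first exact: mulr_ge0.
by apply: le_trans (FG k k0) _; rewrite -mulrA ler_wpM2l ?GH.
Qed.

Lemma dominatedZ a F G : 0 <= a -> dominated F G ->
  dominated (fun k => a * F k) G.
Proof.
move=> a0 [c c0 FG]; exists (a * c) => [|k k0]; first exact: mulr_ge0.
by rewrite -mulrA ler_wpM2l ?FG.
Qed.

Lemma dominated_sum (I : finType) (F_ : I -> nat -> R) G :
  (forall i, dominated (F_ i) G) -> dominated (fun k => \sum_i F_ i k) G.
Proof.
move=> domF; have /fin_all_exists[c cP] i :
    exists c, 0 <= c /\ forall k, (0 < k)%N -> F_ i k <= c * G k.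
  by have [c] := domF i; exists c.
exists (\sum_i c i) => [|k k0].
  by rewrite sumr_ge0 // => i _; case: (cP i).
by rewrite mulr_suml ler_sum // => i _; case: (cP i) => _; apply.
Qed.

Lemma dominated_le F G : (forall k, (0 < k)%N -> F k <= G k) -> dominated F G.
Proof. by move=> FG; exists 1 => // k k0; rewrite mul1r FG. Qed.

(** Bernoulli's inequality is used twice: it gives some [y < 1] such that
    [x <= y ^ (d + 1)], which reduces the claim to a bound on [k * y ^ k], and
    it provides that bound. *)
Lemma poly_expr_bounded (x : R) d : 0 < x < 1 ->
  dominated (fun k => k%:R ^+ d * x ^+ k) (fun=> 1).
Proof.
move=> /andP[x0 x1].
have bernoulli (t : R) k : -1 <= t -> 1 + k%:R * t <= (1 + t) ^+ k.
  move=> t1; elim: k => [|k IHk]; first by rewrite mul0r addr0 expr0.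
  rewrite exprS; have t1' : 0 <= 1 + t by lra.
  apply: le_trans (ler_wpM2l t1' IHk).
  rewrite -subr_ge0 (_ : _ - _ = k%:R * t ^+ 2); last by rewrite -natr1; ring.
  by rewrite mulr_ge0 ?ler0n ?sqr_ge0.
have d0 : 0 < d.+1%:R :> R by rewrite ltr0n.
pose t := (1 - x) / d.+1%:R; pose y := 1 - t.
have t0 : 0 < t by rewrite divr_gt0 // subr_gt0.
have t1 : t < 1.
  rewrite ltr_pdivrMr // mul1r; apply: lt_le_trans (_ : 1 <= _); first lra.
  by rewrite ler1n.
have y0 : 0 < y by rewrite subr_gt0.
have y1 : y < 1 by rewrite /y; lra.
have xy : x <= y ^+ d.+1.
  have tN1 : -1 <= - t by lra.
  apply: le_trans (bernoulli (- t) d.+1 tN1).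
  by rewrite mulrN mulrC divfK ?gt_eqF //; lra.
pose h := y^-1 - 1; have h0 : 0 < h by rewrite subr_gt0 invf_gt1.
have ky k : k%:R * y ^+ k <= h^-1.
  have := @bernoulli h k; rewrite subrKC exprVn => bern.
  rewrite -ler_pdivlMr ?exprn_gt0 // -(ler_pM2r h0) mulrAC mulVf ?gt_eqF //.
  rewrite mul1r; lra.
exists (h^-1 ^+ d) => [|k _]; first by rewrite exprn_ge0 // invr_ge0 ltW.
rewrite mulr1; apply: le_trans (_ : k%:R ^+ d * (y ^+ d.+1) ^+ k <= _).
  by rewrite ler_wpM2l ?exprn_ge0 ?ler0n // lerXn2r ?nnegrE ?exprn_ge0 // ltW.
rewrite exprAC exprSr mulrA -exprMn.
apply: le_trans (_ : (k%:R * y ^+ k) ^+ d <= _).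
  rewrite ler_piMr ?exprn_ge0 ?mulr_ge0 ?exprn_ge0 ?exprn_ile1 //; exact: ltW.
by rewrite lerXn2r ?nnegrE ?ky // ?invr_ge0 ?mulr_ge0 ?exprn_ge0 // ltW.
Qed.

Lemma dominated_exponent (rho : R) l l' : 0 < rho ->
  dominated (fun k => k%:R ^+ l * rho ^+ k) (fun k => k%:R ^+ l' * rho ^+ k) ->
  (l <= l')%N.
Proof.
move=> rho0 [c c0 dom]; rewrite leqNgt; apply/negP => ltl.
have [k ltck] : exists k : nat, c < k.+1%:R.
  by exists (Num.truncn c); have /andP[] := truncn_itv c0.
have := dom k.+1 isT; rewrite mulrA ler_pM2r ?exprn_gt0 // -(subnKC ltl).
rewrite addSn -addnS exprD mulrC ler_pM2r ?exprn_gt0 ?ltr0n //.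
rewrite leNgt => /negP[]; apply: lt_le_trans ltck _.
by rewrite exprS ler_peMr ?ler0n // exprn_ege1 // ler1n.
Qed.

Lemma jordan_blockX m (lam : C) k (a b : 'I_m) :
  (jordan_block m lam ^+ k) a b =
  if (a <= b)%N then 'C(k, b - a)%:R * lam ^+ (k - (b - a)) else 0.
Proof.
elim: k a b => [|k IHk] a b.
  rewrite expr0 mxE bin0n subn_eq0 sub0n expr0 mulr1 -val_eqE eqn_leq.
  by case: (a <= b)%N.
have := mul_jordan_block lam (jordan_block m lam ^+ k) a.
rewrite mulmxE -exprS => /rowP/(_ b); rewrite !mxE summxE IHk => ->.
under eq_bigr => c _ do rewrite mxE IHk.
have [lta|lea] := ltnP a.+1 m.
  rewrite (bigD1 (Ordinal lta)) //= big1 ?addr0; last first.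
    by move=> c /andP[/eqP E /negP[]]; apply/eqP/val_inj.
  case: (ltngtP a b) => [ltab|ltba|eqab].
  - have [d ->] : exists d, b = (a + d.+1)%N :> nat by exists (b - a.+1)%N; lia.
    rewrite addKn addnS subSS addKn.
    have [ltkd|ledk] := ltnP k d.
      by rewrite !bin_small ?mul0r ?mulr0 ?addr0 //; lia.
    rewrite binS natrD mulrDl subSS; congr (_ + _).
    have [ltkd|] := ltnP k d.+1; first by rewrite bin_small ?mul0r ?mulr0.
    by move=> ltdk; rewrite mulrCA -exprS; congr (_ * _ ^+ _); lia.
  - by rewrite mulr0 add0r.
  - by rewrite eqab subnn !bin0 !mul1r !subn0 addr0 exprS.
rewrite big1 ?addr0; last by move=> c /eqP E; have := ltn_ord c; lia.
case: leqP => leab; last by rewrite mulr0.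
have -> : (b - a = 0)%N by have := ltn_ord b; lia.
by rewrite !bin0 !mul1r !subn0 exprS.
Qed.

Lemma intertwine_powers m p (Q : 'M[C]_(m, p)) M J k :
  Q *m M = J *m Q -> Q *m M ^+ k = J ^+ k *m Q.
Proof.
move=> QM; elim: k => [|k IHk]; first by rewrite !expr0 mulmx1 mul1mx.
by rewrite exprSr -mulmxE mulmxA IHk -mulmxA QM mulmxA mulmxE -exprSr.
Qed.

Section JordanForm.
Variables (n : nat) (M : 'M[C]_n) (s : nat) (size_ : 'I_s -> nat).
Variables (lam_ : 'I_s -> C).
Hypothesis formM : is_jordan_form M size_ lam_.

(** Cutting the base change matrices along the blocks relates the powers of [M]
    to the powers of each single Jordan block. *)
Lemma jordan_form_blocks : exists (P_ : forall i, 'M[C]_(n, size_ i))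
    (Q_ : forall i, 'M[C]_(size_ i, n)),
  [/\ forall i, Q_ i *m P_ i = 1%:M,
      \sum_i P_ i *m Q_ i = 1%:M,
      forall i, Q_ i *m M = jordan_block (size_ i) (lam_ i) *m Q_ i &
      forall i, M *m P_ i = P_ i *m jordan_block (size_ i) (lam_ i)].
Proof.
have [_ [P [Q [PQ QP QMP]]]] := formM.
exists (fun i => submxrow P i), (fun i => submxcol Q i); split=> [i||i|i].
- rewrite -(submxblock_diag (fun i => 1%:M : 'M[C]_(size_ i)) i) mxdiagZ -QP.
  by rewrite submxblockEh -mul_submxrow submxcol_mul.
- by rewrite -mul_mxrow_mxcol submxrowK submxcolK.
- have QM : Q *m M = (\mxdiag_i jordan_block (size_ i) (lam_ i)) *m Q.
    by rewrite -QMP -mulmxA PQ mulmx1.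
  rewrite submxcol_mul QM -[in LHS](submxcolK Q) mul_mxdiag_mxcol.
  by rewrite mxcolK.
have MP : M *m P = P *m (\mxdiag_i jordan_block (size_ i) (lam_ i)).
  by rewrite -QMP !mulmxA PQ mul1mx.
rewrite mul_submxrow MP -[in LHS](submxrowK P) mul_mxrow_mxdiag.
by rewrite mxrowK.
Qed.

Lemma size_le_dim i : (size_ i <= n)%N.
Proof.
have [P_ [Q_ [QP _ _ _]]] := jordan_form_blocks.
rewrite -(mxrank1 C (size_ i)) -(QP i).
exact: leq_trans (mxrankM_maxl _ _) (rank_leq_col _).
Qed.

(** The corner ['C(k, l) * lam ^ (k - l)] of the power of the block has the
    right order of growth once [l <= k]; for smaller [k] it vanishes, and the
    diagonal entry [lam ^ k] takes over. *)
Lemma dominated_corner i l (rho : R) :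
  0 < rho -> Normc.normc (lam_ i) = rho -> size_ i = l.+1 ->
  dominated (fun k => k%:R ^+ l * rho ^+ k) (fun k => mxnorm (M ^+ k)).
Proof.
move=> rho0 lamE sizeE; have [P_ [Q_ [QP _ QM _]]] := jordan_form_blocks.
pose J := jordan_block (size_ i) (lam_ i).
have JX k : J ^+ k = Q_ i *m M ^+ k *m P_ i.
  by rewrite (intertwine_powers k (QM i)) -mulmxA QP mulmx1.
have domJ : dominated (fun k => mxnorm (J ^+ k)) (fun k => mxnorm (M ^+ k)).
  exists (mxnorm (Q_ i) * mxnorm (P_ i)) => [|k _].
    by rewrite mulr_ge0 ?mxnorm_ge0.
  rewrite JX mulrAC; apply: le_trans (mxnormM _ _) _.
  by rewrite ler_wpM2r ?mxnorm_ge0 ?mxnormM.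
apply: dominated_trans domJ.
(* The constant of [expn_le_bin], with [rho ^+ l] making up for [k - l]. *)
exists ((l ^ l)%:R * (1 + l`!%:R * rho ^+ l)) => [|k _].
  by rewrite mulr_ge0 ?addr_ge0 ?mulr_ge0 ?exprn_ge0 ?(ltW rho0).
have l_lt : (0 < size_ i)%N /\ (l < size_ i)%N by rewrite sizeE.
case: l_lt => size_gt0 lt_l.
have diag : rho ^+ k <= mxnorm (J ^+ k).
  apply: le_trans (entry_le_mxnorm _ (Ordinal size_gt0) (Ordinal size_gt0)).
  by rewrite jordan_blockX leqnn subnn bin0 mul1r subn0 normcX lamE.
have corner : 'C(k, l)%:R * rho ^+ (k - l) <= mxnorm (J ^+ k).
  apply: le_trans (entry_le_mxnorm _ (Ordinal size_gt0) (Ordinal lt_l)).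
  by rewrite jordan_blockX leq0n subn0 Normc.normcM normc_nat normcX lamE.
have bin_corner : 'C(k, l)%:R * rho ^+ k <= rho ^+ l * mxnorm (J ^+ k).
  have [ltkl|lelk] := ltnP k l.
    by rewrite bin_small // mul0r mulr_ge0 ?exprn_ge0 ?mxnorm_ge0 ?(ltW rho0).
  rewrite -[X in rho ^+ X](subnK lelk) exprD mulrA mulrC.
  by rewrite ler_wpM2l ?exprn_ge0 ?(ltW rho0).
apply: le_trans (_ : (l ^ l * (1 + l`! * 'C(k, l)))%:R * rho ^+ k <= _).
  by rewrite ler_wpM2r ?exprn_ge0 ?(ltW rho0) // -natrX ler_nat expn_le_bin.
rewrite natrM natrD natrM -!mulrA ler_wpM2l ?ler0n //.
rewrite mulrDl mul1r [leRHS]mulrDl mul1r lerD // -!mulrA.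
by rewrite ler_wpM2l ?ler0n.
Qed.

(** When [x < rho], the polynomial factor is absorbed by replacing [x] with
    some [r] strictly between [x] and [rho]. The number [r] is also positive,
    which allows [r ^+ (k - d)] to be compared with [r ^+ k]. *)
Lemma dominated_entry (x rho : R) d l :
  0 <= x -> 0 < rho -> x < rho \/ (x = rho /\ (d <= l)%N) ->
  dominated (fun k => 'C(k, d)%:R * x ^+ (k - d))
            (fun k => k%:R ^+ l * rho ^+ k).
Proof.
move=> x0 rho0 x_rho.
have [r [r0 ler domr]] : exists r, [/\ 0 < r, x <= r &
    dominated (fun k => k%:R ^+ d * r ^+ k) (fun k => k%:R ^+ l * rho ^+ k)].
  case: x_rho => [ltx|[-> ledl]]; last first.
    exists rho; split=> //; apply: dominated_le => k k_gt0.
    by rewrite ler_wpM2r ?exprn_ge0 ?(ltW rho0) // ler_weXn2l // ler1n.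
  pose r := (x + rho) / 2; exists r.
  have r0 : 0 < r by rewrite /r; lra.
  have ltr : r < rho by rewrite /r; lra.
  split=> //; first by rewrite /r; lra.
  have quot : 0 < r / rho < 1 by rewrite divr_gt0 // ltr_pdivrMr // mul1r.
  have [c c0 cP] := poly_expr_bounded d quot; exists c => // k k_gt0.
  have := cP k k_gt0.
  rewrite mulr1 exprMn exprVn mulrA ler_pdivrMr ?exprn_gt0 //.
  move/le_trans; apply; rewrite ler_wpM2l // ler_peMl ?exprn_ge0 ?(ltW rho0) //.
  by rewrite exprn_ege1 // ler1n.
apply: dominated_trans domr; exists (r ^- d) => [|k _].
  by rewrite invr_ge0 exprn_ge0 ?(ltW rho0) ?(ltW r0).
have [ltkd|ledk] := ltnP k d.
  by rewrite bin_small // mul0r !mulr_ge0 ?invr_ge0 ?exprn_ge0 ?(ltW r0).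
have rk : r ^+ k = r ^+ (k - d) * r ^+ d by rewrite -exprD subnK.
have rd : r ^+ d != 0 by rewrite expf_neq0 ?gt_eqF.
rewrite rk mulrCA [r ^- d * _]mulrC mulfK //.
rewrite ler_pM ?ler0n ?exprn_ge0 //; last by rewrite lerXn2r // nnegrE ltW.
by rewrite -natrX ler_nat bin_le_expn.
Qed.

Lemma dominated_powers l (rho : R) : 0 < rho ->
  (forall i, Normc.normc (lam_ i) <= rho) ->
  (forall i, Normc.normc (lam_ i) = rho -> (size_ i <= l.+1)%N) ->
  dominated (fun k => mxnorm (M ^+ k)) (fun k => k%:R ^+ l * rho ^+ k).
Proof.
move=> rho0 lam_le size_le; have [P_ [Q_ [_ PQ QM _]]] := jordan_form_blocks.
pose J i := jordan_block (size_ i) (lam_ i).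
have MX k : M ^+ k = \sum_i P_ i *m J i ^+ k *m Q_ i.
  rewrite -[LHS]mul1mx -PQ mulmx_suml; apply: eq_bigr => i _.
  by rewrite -!mulmxA (intertwine_powers k (QM i)).
apply: dominated_trans (_ : dominated (fun k =>
  \sum_i (mxnorm (P_ i) * mxnorm (Q_ i)) * mxnorm (J i ^+ k)) _).
  apply: dominated_le => k _; rewrite MX; apply: le_trans (mxnorm_sum _) _.
  apply: ler_sum => i _; rewrite mulrAC; apply: le_trans (mxnormM _ _) _.
  by rewrite ler_wpM2r ?mxnorm_ge0 ?mxnormM.
apply: dominated_sum => i; apply: dominatedZ.
  by rewrite mulr_ge0 ?mxnorm_ge0.
apply: dominated_sum => a; apply: dominated_sum => b.
have [leab|ltba] := leqP a b; last first.
  exists 0 => // k _; rewrite jordan_blockX leqNgt ltba Normc.normc0 mul0r //.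
apply: dominated_trans (_ : dominated
  (fun k => 'C(k, b - a)%:R * Normc.normc (lam_ i) ^+ (k - (b - a))) _).
  apply: dominated_le => k _.
  by rewrite jordan_blockX leab Normc.normcM normc_nat normcX.
apply: dominated_entry => //; first exact: normc_ge0.
have := lam_le i; rewrite le_eqVlt => /predU1P[eq_rho|]; last by left.
right; split=> //; have := size_le i eq_rho; have := ltn_ord b; lia.
Qed.

Lemma jordan_eigenvalue i : eigenvalue M (lam_ i).
Proof.
have [size_gt0 _] := formM; have [P_ [Q_ [QP _ QM _]]] := jordan_form_blocks.
have lt_last : ((size_ i).-1 < size_ i)%N by rewrite prednK.
pose a := Ordinal lt_last; apply/eigenvalueP; exists (row a (Q_ i)).
  rewrite -row_mul QM mul_jordan_block big1 ?addr0 // => b /eqP /= E.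
  by have := ltn_ord b; rewrite E prednK ?ltnn.
apply/eqP => Qa0; have := congr1 (row a) (QP i); rewrite row_mul Qa0 mul0mx.
by move/rowP/(_ a); rewrite !mxE eqxx => /eqP; rewrite eq_sym oner_eq0.
Qed.

Lemma eigenvalue_jordan (a : C) : eigenvalue M a -> exists i, a = lam_ i.
Proof.
case/eigenvalueP => v vM v0; have [P_ [Q_ [_ PQ _ MP]]] := jordan_form_blocks.
have [i vPi] : exists i, v *m P_ i != 0.
  apply/existsP; apply: contraNT v0 => /existsPn vP.
  rewrite -[v]mulmx1 -PQ mulmx_sumr big1 // => i _.
  by rewrite mulmxA; have /negPn/eqP -> := vP i; rewrite mul0mx.
exists i; have [|-> //] := @jordan_block_eigenvector _ _ (lam_ i) a _ _ vPi.
by rewrite -mulmxA -MP mulmxA vM scalemxAl.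
Qed.

End JordanForm.

End Growth.

(** * Integer matrices *)

Section IntegerMatrix.
Variables (R : realType) (n : nat) (A : 'M[int]_n).
Local Notation M := (complex_mx R A).
Local Notation rho := (spectral_radius R A).

Lemma complex_mxX k : M ^+ k = map_mx intr (A ^+ k).
Proof.
elim: k => [|k IHk]; first by rewrite !expr0 map_mx1.
by rewrite !exprS IHk -!mulmxE map_mxM.
Qed.

Lemma mxnorm_complex_mx k :
  mxnorm (M ^+ k) = (\sum_i \sum_j absz ((A ^+ k) i j))%:R.
Proof.
rewrite complex_mxX natr_sum; apply: eq_bigr => i _; rewrite natr_sum.
by apply: eq_bigr => j _; rewrite mxE normc_int.
Qed.

Lemma dominated_degree_mxnorm :
  dominated (fun k => (degree_iter R A k)%:R) (fun k => mxnorm (M ^+ k)).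
Proof.
exists 2 => // k _; rewrite /degree_iter degree_iter_monomial_map.
by rewrite mxnorm_complex_mx -natrM ler_nat degree_le_entries.
Qed.

Lemma dominated_mxnorm_degree :
  dominated (fun k => mxnorm (M ^+ k)) (fun k => (degree_iter R A k)%:R).
Proof.
exists (n * n)%:R => [|k _]; first exact: ler0n.
rewrite /degree_iter degree_iter_monomial_map mxnorm_complex_mx -natrM ler_nat.
rewrite -mulnA -[X in (_ <= X * _)%N]card_ord -sum_nat_const.
apply: leq_sum => i _; rewrite -[X in (_ <= X * _)%N]card_ord -sum_nat_const.
by apply: leq_sum => j _; exact: entry_le_degree.
Qed.

Hypothesis detA : \det A != 0.

Lemma eigenvalue_neq0 (a : complex R) : eigenvalue M a -> a != 0.
Proof.
case/eigenvalueP => v vM v0; apply: contraNneq v0 => a0.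
have unitM : M \in unitmx by rewrite unitmxE det_map_mx unitfE intr_eq0.
by rewrite -[v](mulmxK unitM) vM a0 scale0r mul0mx.
Qed.

Section Jordan.
Variables (s : nat) (size_ : 'I_s -> nat) (lam_ : 'I_s -> complex R).
Hypothesis formM : is_jordan_form M size_ lam_.
Local Notation normc := (@Normc.normc R).

Lemma spectral_radius_max i0 :
  (forall i, normc (lam_ i) <= normc (lam_ i0)) -> rho = normc (lam_ i0).
Proof.
move=> max_i0; pose E := [set normc z | z in [set z | eigenvalue M z]]%classic.
have ubE : ubound E (normc (lam_ i0)).
  by move=> _ [z /= /(eigenvalue_jordan formM)[i ->] <-].
have E0 : E (normc (lam_ i0)).
  by exists (lam_ i0) => //; apply: jordan_eigenvalue formM i0.
apply/le_anti/andP; split.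
  by apply: sup_le_ub => //; exists (normc (lam_ i0)).
by apply: ub_le_sup E0; exists (normc (lam_ i0)).
Qed.

End Jordan.

(** The supremum defining [rho] is attained, the eigenvalues being finite in
    number, and [rho] is positive because zero is not an eigenvalue of [A]. *)
Lemma dominant_block_exists : (0 < n)%N ->
  exists s (size_ : 'I_s -> nat) (lam_ : 'I_s -> complex R) i1,
  [/\ is_jordan_form M size_ lam_, Normc.normc (lam_ i1) = rho, 0 < rho,
      forall i, Normc.normc (lam_ i) <= rho &
      forall i, Normc.normc (lam_ i) = rho -> (size_ i <= size_ i1)%N].
Proof.
move=> n_gt0; have [s [size_ [lam_ formM]]] := exists_jordan_form M.
have [i _] : exists i : 'I_s, true.
  have [P_ [Q_ [_ PQ _ _]]] := jordan_form_blocks formM.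
  case: s size_ lam_ formM P_ Q_ PQ => [|s] size_ lam_ formM P_ Q_;
    last by exists ord0.
  rewrite big_ord0 => /matrixP/(_ (Ordinal n_gt0) (Ordinal n_gt0)).
  by rewrite !mxE eqxx => /eqP; rewrite eq_sym oner_eq0.
pose f j := Normc.normc (lam_ j).
case: (@Order.TotalTheory.arg_maxP _ _ _ i xpredT f isT) => i0 _ max_i0.
have rhoE := spectral_radius_max formM (fun j => max_i0 j isT).
case: (@arg_maxnP _ i0 (fun j => f j == rho) size_) => [|i1 /eqP i1_rho max_i1].
  by rewrite /f rhoE.
exists s, size_, lam_, i1; split=> //; last 2 first.
- by move=> j; rewrite rhoE; apply: max_i0.
- by move=> j /eqP; apply: max_i1.
rewrite rhoE lt_def normc_ge0 andbT.
apply: contraTneq (jordan_eigenvalue formM i0).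
move=> /Normc.eq0_normc lam0; apply/negP => /eigenvalue_neq0.
by rewrite lam0 eqxx.
Qed.

End IntegerMatrix.

Theorem theorem6p2 (R : realType) (n : nat) (n_gt0 : (0 < n)%N)
    (A : 'M[int]_n) (detA : \det A != 0) :
  exists (C0 C1 : R) (l : nat),
    [/\ 0 < C0 /\ C0 <= C1,
        (l <= n.-1)%N,
        degree_bounds A C0 C1 l,
        (forall (l' : nat) (D0 D1 : R), (l' <= n.-1)%N ->
           0 < D0 -> D0 <= D1 -> degree_bounds A D0 D1 l' -> l' = l) &
        largest_dominant_jordan_block R A l.+1].
Proof.
have [s [size_ [lam_ [i1]]]] := dominant_block_exists R detA n_gt0.
case=> formM lam_i1 rho0 lam_le size_le.
set rho := spectral_radius R A in lam_i1 rho0 lam_le size_le.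
pose g l k : R := k%:R ^+ l * rho ^+ k.
pose d k : R := (degree_iter R A k)%:R.
have [size_gt0 _] := formM; pose l := (size_ i1).-1.
have sizeE : size_ i1 = l.+1 by rewrite prednK.
have dom_lower : dominated (g l) d.
  apply: dominated_trans (dominated_mxnorm_degree R A).
  exact: (dominated_corner formM rho0 lam_i1 sizeE).
have dom_upper : dominated d (g l).
  apply: dominated_trans (dominated_degree_mxnorm R A) _.
  by apply: (dominated_powers formM) => // i lamE; rewrite -sizeE size_le.
have g_gt0 j k : (0 < k)%N -> 0 < g j k.
  by move=> k0; rewrite mulr_gt0 ?exprn_gt0 ?ltr0n.
have dom_bounds (D0 D1 : R) j : 0 < D0 -> degree_bounds A D0 D1 j ->
    dominated (g j) d /\ dominated d (g j).
  move=> D0_gt0 bounds; split.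
    exists D0^-1 => [|k k0]; first by rewrite invr_ge0 ltW.
    rewrite mulrC ler_pdivlMr // mulrC mulrA.
    by have /andP[] := bounds k k0.
  exists D1 => [|k k0].
    have /andP[lo hi] := bounds 1%N isT.
    have := le_trans lo hi; rewrite -!mulrA !(ler_pM2r (g_gt0 j 1%N isT)).
    exact/le_trans/ltW.
  by rewrite mulrA; have /andP[] := bounds k k0.
have [c c0 cP] := dom_lower; have [C C0 CP] := dom_upper.
have c_gt0 : 0 < c.
  rewrite lt_def c0 andbT; apply: contraTneq (cP 1%N isT) => ->.
  by rewrite mul0r -ltNge g_gt0.
exists c^-1, C, l; split.
- split; first by rewrite invr_gt0.
  have := le_trans (cP 1%N isT) (ler_wpM2l c0 (CP 1%N isT)).
  rewrite mulrA -[leLHS]mul1r (ler_pM2r (g_gt0 l 1%N isT)) => cC.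
  by rewrite -(ler_pM2l c_gt0) mulfV ?gt_eqF.
- by have := size_le_dim formM i1; rewrite sizeE; lia.
- move=> k k0; apply/andP; split; last by rewrite -mulrA CP.
  by rewrite -mulrA mulrC ler_pdivrMr // [leRHS]mulrC; exact: cP.
- move=> l' D0 D1 _ D0_gt0 _ /(dom_bounds _ _ _ D0_gt0)[lower upper].
  apply/eqP; rewrite eqn_leq.
  apply/andP; split; apply: (dominated_exponent rho0).
    exact: dominated_trans lower dom_upper.
  exact: dominated_trans dom_lower upper.
split.
  by exists (lam_ i1) => //; exists s, size_, lam_; split=> //; exists i1.
move=> m lam lamE [s' [size' [lam' [form' [i [<- lam'E]]]]]].
have [size'_gt0 _] := form'; rewrite -(prednK (size'_gt0 i)) ltnS.
apply: (dominated_exponent rho0); apply: dominated_trans dom_upper.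
apply: dominated_trans (dominated_mxnorm_degree R A).
have sizeE' := esym (prednK (size'_gt0 i)).
by apply: (dominated_corner form' rho0 _ sizeE'); rewrite lam'E.
Qed.
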